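(* Let $\xi$ be an isometric infinitesimal deformation of a smooth surface $M\subset\mathbb{R}^3$, and let $\eta$ and $\tau$ be its rotation and translation vector fields. Then $$d\eta = J\dot B,$$ where $J \colon TM\to TM$ is the rotation by $\pi/2$, and $$\top\circ d\tau = -h\dot B,$$ where $\top\colon\mathbb{R}^3\to TM$ is the orthogonal projection and $h \colon M\to\mathbb{R}$ is the support function of $M$.
   Context: An infinitesimal deformation of $M$ is a smooth map $\xi\colon M\to\mathbb{R}^3$; put $\phi_t(x)=x+t\xi(x)$, $M_t=\phi_t(M)$, and let $g_t$ be the induced metric on $M_t$. $\xi$ is isometric if $\frac{d}{dt}\big|_{t=0}\phi_t^*g_t=0$. Let $p\colon M\to\mathbb{R}^3$, $p(x)=x$. For every isometric $\xi$ there is a unique pair of maps $\eta,\tau\colon M\to\mathbb{R}^3$ with $\xi=\eta\times p+\tau$, $d\xi=\eta\times dp$, $d\tau=p\times d\eta$; they are the rotation and translation vector fields of $\xi$. One has $d\eta(X)\in TM$ for $X\in TM$ (free vectors in $\mathbb{R}^3$ being identified by parallel translation), so $d\eta$ is viewed as an endomorphism field of $TM$. Let $\nu$ be a (local) unit normal field on $M$ and $\nu_t$ the corresponding unit normal field on $M_t$. The shape operators are $B=d\nu\colon TM\to TM$ and $B_t=d\nu_t\colon TM_t\to TM_t$, and $\dot B=\lim_{t\to0}\frac{\phi_t^*B_t-B}{t}$, where $\phi_t^*B_t=(d\phi_t)^{-1}\circ B_t\circ d\phi_t$. The rotation $J$ is $J(X)=\nu\times X$. The support function is $h(x)=\langle\nu(x),x\rangle$.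 *)

(* Defs.v *)
From HB Require Import structures.
From mathcomp Require Import all_boot all_order all_algebra.
From mathcomp Require Import all_classical all_reals all_analysis.

Set Implicit Arguments.
Unset Strict Implicit.
Unset Printing Implicit Defensive.

Import Order.TTheory GRing.Theory Num.Theory.
Import numFieldNormedType.Exports.
Local Open Scope classical_set_scope.
Local Open Scope ring_scope.

Definition dot {R : realType} (u v : 'rV[R]_3) : R :=
  \sum_(i < 3) u 0 i * v 0 i.

(* Indices are added in 'I_3 = Z/3. *)
Definition cross {R : realType} (u v : 'rV[R]_3) : 'rV[R]_3 :=
  \row_(i < 3) (u 0 (i + 1) * v 0 (i + 2) - u 0 (i + 2) * v 0 (i + 1)).

Fixpoint Ck {R : realType} {V W : normedModType R}
    (k : nat) (U : set V) (f : V -> W) : Prop :=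
  match k with
  | 0 => forall x, U x -> {for x, continuous f}
  | k'.+1 => (forall x, U x -> differentiable f x) /\
             (forall v : V, Ck k' U (fun x => 'D_v f x))
  end.

Definition smooth_on {R : realType} {V W : normedModType R}
    (U : set V) (f : V -> W) : Prop := forall k, Ck k U f.

(* f restricted to U is a smooth immersion and a homeomorphism onto a
   relatively open subset of M: the last clause says that f, with values in M,
   is an open map for the subspace topology of M. *)
Definition chart {R : realType} (M : set 'rV[R]_3)
    (U : set 'rV[R]_2) (f : 'rV[R]_2 -> 'rV[R]_3) : Prop :=
  [/\ open U,
      smooth_on U f,
      forall u v, U u -> 'D_v f u = 0 -> v = 0,
      (forall u u', U u -> U u' -> f u = f u' -> u = u') &
      forall U', open U' -> U' `<=` U ->
        exists W : set 'rV[R]_3, open W /\ f @` U' = M `&` W].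

Definition smooth_surface {R : realType} (M : set 'rV[R]_3) : Prop :=
  forall x, M x -> exists U f, chart M U f /\ exists u, U u /\ f u = x.

(* Maps M -> R^3 are total functions of which only the values on M matter. *)
Definition smooth_map {R : realType} (M : set 'rV[R]_3)
    (F : 'rV[R]_3 -> 'rV[R]_3) : Prop :=
  forall U f, chart M U f -> smooth_on U (F \o f).

Definition tangent {R : realType} (M : set 'rV[R]_3) (x : 'rV[R]_3)
    : set 'rV[R]_3 :=
  [set X | exists U f u v, [/\ chart M U f, U u, f u = x & 'D_v f u = X]].

(* dF_x(X) = D_v (F o f)(u), where f is a chart with f(u) = x and
   D_v f (u) = X; for F differentiable near x on M this does not depend on the
   choice of (f, u, v). *)
Definition dsurf {R : realType} (M : set 'rV[R]_3)
    (F : 'rV[R]_3 -> 'rV[R]_3) (x X : 'rV[R]_3) : 'rV[R]_3 :=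
  xget 0 [set Y | exists U f u v,
    [/\ chart M U f, U u, f u = x, 'D_v f u = X & Y = 'D_v (F \o f) u]].

Definition phi {R : realType} (xi : 'rV[R]_3 -> 'rV[R]_3) (t : R)
    (x : 'rV[R]_3) : 'rV[R]_3 := x + t *: xi x.

(* The pullback by F of the metric induced on F(M) by the Euclidean one. *)
Definition pullback_metric {R : realType} (M : set 'rV[R]_3)
    (F : 'rV[R]_3 -> 'rV[R]_3) (x X Y : 'rV[R]_3) : R :=
  dot (dsurf M F x X) (dsurf M F x Y).

Definition isometric_deformation {R : realType} (M : set 'rV[R]_3)
    (xi : 'rV[R]_3 -> 'rV[R]_3) : Prop :=
  smooth_map M xi /\
  forall x X Y, M x -> tangent M x X -> tangent M x Y ->
    is_derive (0 : R) 1 (fun t : R => pullback_metric M (phi xi t) x X Y) 0.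

Definition rotation_translation_fields {R : realType} (M : set 'rV[R]_3)
    (xi eta tau : 'rV[R]_3 -> 'rV[R]_3) : Prop :=
  [/\ smooth_map M eta, smooth_map M tau,
      forall x, M x -> xi x = cross (eta x) x + tau x,
      forall x X, M x -> tangent M x X ->
        dsurf M xi x X = cross (eta x) (dsurf M id x X) &
      forall x X, M x -> tangent M x X ->
        dsurf M tau x X = cross x (dsurf M eta x X)].

Definition unit_normal_field {R : realType} (M : set 'rV[R]_3)
    (nu : 'rV[R]_3 -> 'rV[R]_3) : Prop :=
  [/\ smooth_map M nu,
      forall x, M x -> dot (nu x) (nu x) = 1 &
      forall x X, M x -> tangent M x X -> dot (nu x) X = 0].

(* The value at F(x) of the unit normal field of the immersed surface F(M)
   that corresponds to nu, i.e. the one for which dF is orientation preserving;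
   it is uniquely determined as soon as dF_x is injective.  Fields on F(M) are
   given as maps on M, that is, composed with F. *)
Definition transported_normal {R : realType} (M : set 'rV[R]_3)
    (nu F : 'rV[R]_3 -> 'rV[R]_3) (x : 'rV[R]_3) : 'rV[R]_3 :=
  xget 0 [set n |
    [/\ dot n n = 1,
        forall X, tangent M x X -> dot n (dsurf M F x X) = 0 &
        forall X Y, tangent M x X -> tangent M x Y ->
          0 < dot (nu x) (cross X Y) ->
          0 < dot n (cross (dsurf M F x X) (dsurf M F x Y))]].

Definition dsurf_inv {R : realType} (M : set 'rV[R]_3)
    (F : 'rV[R]_3 -> 'rV[R]_3) (x Z : 'rV[R]_3) : 'rV[R]_3 :=
  xget 0 [set X | tangent M x X /\ dsurf M F x X = Z].

(* The differential at F(x), on the tangent plane dF(T_x M) of F(M), of the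
   field on F(M) whose value at F(x) is N(x). *)
Definition dsurf_along {R : realType} (M : set 'rV[R]_3)
    (F N : 'rV[R]_3 -> 'rV[R]_3) (x Z : 'rV[R]_3) : 'rV[R]_3 :=
  dsurf M N x (dsurf_inv M F x Z).

Definition shape_op {R : realType} (M : set 'rV[R]_3)
    (nu : 'rV[R]_3 -> 'rV[R]_3) (x X : 'rV[R]_3) : 'rV[R]_3 :=
  dsurf M nu x X.

Definition deformed_shape_op {R : realType} (M : set 'rV[R]_3)
    (xi nu : 'rV[R]_3 -> 'rV[R]_3) (t : R) (x Z : 'rV[R]_3) : 'rV[R]_3 :=
  dsurf_along M (phi xi t) (transported_normal M nu (phi xi t)) x Z.

Definition pullback_shape_op {R : realType} (M : set 'rV[R]_3)
    (xi nu : 'rV[R]_3 -> 'rV[R]_3) (t : R) (x X : 'rV[R]_3) : 'rV[R]_3 :=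
  dsurf_inv M (phi xi t) x
    (deformed_shape_op M xi nu t x (dsurf M (phi xi t) x X)).

Definition shape_op_quotient {R : realType} (M : set 'rV[R]_3)
    (xi nu : 'rV[R]_3 -> 'rV[R]_3) (x X : 'rV[R]_3) (t : R) : 'rV[R]_3 :=
  t^-1 *: (pullback_shape_op M xi nu t x X - shape_op M nu x X).

Definition shape_op_dot {R : realType} (M : set 'rV[R]_3)
    (xi nu : 'rV[R]_3 -> 'rV[R]_3) (x X : 'rV[R]_3) : 'rV[R]_3 :=
  lim (shape_op_quotient M xi nu x X t @[t --> (0 : R)^']).

Definition rotJ {R : realType} (nu : 'rV[R]_3 -> 'rV[R]_3)
    (x X : 'rV[R]_3) : 'rV[R]_3 := cross (nu x) X.

Definition support_fun {R : realType} (nu : 'rV[R]_3 -> 'rV[R]_3)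
    (x : 'rV[R]_3) : R := dot (nu x) x.

Definition orth_proj {R : realType} (T : set 'rV[R]_3) (v : 'rV[R]_3)
    : 'rV[R]_3 :=
  xget 0 [set y | T y /\ forall z, T z -> dot (v - y) z = 0].

(* Main.v *)
(** With [d xi = eta x dp], the deformation [phi_t] has differential
    [A_t = 1 + t [eta x]] on every tangent plane.  [A_t] is invertible for all
    [t], since [A_t X = 0] gives [<A_t X, X> = |X|^2 = 0], and its cofactor
    matrix is [cof(A_t) v = v + t (eta x v) + t^2 <eta, v> eta].  Hence the
    normal of [M_t] is [cof(A_t) nu] normalised, an explicit function of [eta]
    and [nu].  Differentiating it along [M], applying
    [A_t^-1 = cof(A_(-t)) / det A_t] and letting [t] tend to [0] shows that the
    derivative of the shape operator maps [X] to [d eta(X) x nu].  Comparing the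
    mixed second derivatives of [xi] and of [p] in a chart gives
    [d eta(X) x Y = d eta(Y) x X], hence [d eta(X)] is orthogonal to [nu]; both
    formulas then follow from the expansion of the double cross product. *)
Require Import Defs.
From HB Require Import structures.
From mathcomp Require Import all_boot all_order all_algebra.
From mathcomp Require Import all_classical all_reals all_analysis.
From mathcomp Require Import ring lra.

Set Implicit Arguments.
Unset Strict Implicit.
Unset Printing Implicit Defensive.

Import Order.TTheory GRing.Theory Num.Theory.
Import numFieldNormedType.Exports.
Local Open Scope classical_set_scope.
Local Open Scope ring_scope.

(** * Vector algebra in dimension three *)

Section VectorAlgebra.
Variable R : realType.
Implicit Types (a b c u v w : 'rV[R]_3) (k : R).

Lemma row3P u v :
  u 0 0 = v 0 0 -> u 0 1 = v 0 1 -> u 0 2 = v 0 2 -> u = v.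
Proof.
move=> e0 e1 e2; apply/rowP => -[[|[|[|//]]] h].
- by rewrite (_ : Ordinal h = 0) //; apply: val_inj.
- by rewrite (_ : Ordinal h = 1) //; apply: val_inj.
- by rewrite (_ : Ordinal h = 2) //; apply: val_inj.
Qed.

Lemma dotE u v :
  dot u v = u 0 0 * v 0 0 + u 0 1 * v 0 1 + u 0 2 * v 0 2.
Proof.
rewrite /dot !big_ord_recl big_ord0 addr0 addrA.
by congr (_ * _ + _ * _ + _ * _); congr (_ _ _); apply: val_inj.
Qed.

Lemma crossE u v :
  ((cross u v 0 0 = u 0 1 * v 0 2 - u 0 2 * v 0 1) *
   (cross u v 0 1 = u 0 2 * v 0 0 - u 0 0 * v 0 2) *
   (cross u v 0 2 = u 0 0 * v 0 1 - u 0 1 * v 0 0))%type.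
Proof.
have e3 : 1 + 2 = 0 :> 'I_3 by apply: val_inj.
have e4 : 2 + 2 = 1 :> 'I_3 by apply: val_inj.
have e5 : 2 + 1 = 0 :> 'I_3 by apply: val_inj.
have e6 : 1 + 1 = 2 :> 'I_3 by apply: val_inj.
by split; [split|]; rewrite mxE ?add0r ?e3 ?e4 ?e5 ?e6.
Qed.

Lemma dotC u v : dot u v = dot v u.
Proof. by rewrite !dotE; ring. Qed.

Lemma dotDr u v w : dot u (v + w) = dot u v + dot u w.
Proof. by rewrite !(dotE, mxE); ring. Qed.

Lemma dotZr k u v : dot u (k *: v) = k * dot u v.
Proof. by rewrite !(dotE, mxE); ring. Qed.

Lemma dotZl k u v : dot (k *: u) v = k * dot u v.
Proof. by rewrite !(dotE, mxE); ring. Qed.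

Lemma dot0r u : dot u 0 = 0.
Proof. by rewrite !(dotE, mxE); ring. Qed.

Lemma dot_eq0 u : dot u u = 0 -> u = 0.
Proof.
rewrite dotE => h.
have h0 := sqr_ge0 (u 0 0); have h1 := sqr_ge0 (u 0 1).
have h2 := sqr_ge0 (u 0 2); rewrite !expr2 in h0 h1 h2.
apply: row3P; rewrite mxE; apply/eqP; rewrite -sqrf_eq0 expr2; apply/eqP; lra.
Qed.

Lemma dot_ge0 u : 0 <= dot u u.
Proof. by rewrite dotE -!expr2 !addr_ge0 ?sqr_ge0. Qed.

Lemma crossC u v : cross u v = - cross v u.
Proof. by apply: row3P; rewrite !(crossE, mxE); ring. Qed.

Lemma crossZr k u v : cross u (k *: v) = k *: cross u v.
Proof. by apply: row3P; rewrite !(crossE, mxE); ring. Qed.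

Lemma crossZl k u v : cross (k *: u) v = k *: cross u v.
Proof. by apply: row3P; rewrite !(crossE, mxE); ring. Qed.

Lemma crossr0 u : cross u 0 = 0.
Proof. by apply: row3P; rewrite !(crossE, mxE); ring. Qed.

Lemma dot_crossl a b : dot a (cross a b) = 0.
Proof. by rewrite !(dotE, crossE); ring. Qed.

Lemma dot_crossr a b : dot b (cross a b) = 0.
Proof. by rewrite !(dotE, crossE); ring. Qed.

Lemma cross_crossr a b c :
  cross a (cross b c) = dot a c *: b - dot a b *: c.
Proof. by apply: row3P; rewrite !(dotE, crossE, mxE); ring. Qed.

Lemma dot_cross_cross a b c :
  dot a (cross b (cross c a)) = dot c a * dot a b - dot a a * dot c b.
Proof. by rewrite !(dotE, crossE); ring. Qed.

(** Two candidates differ by a vector of [T] that is orthogonal to [T], hence to itself, so closure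
    of [T] under subtraction already forces uniqueness. *)
Lemma orth_projE (T : set 'rV[R]_3) v u :
  (forall a b, T a -> T b -> T (a - b)) -> T u ->
  (forall w, T w -> dot (v - u) w = 0) -> orth_proj T v = u.
Proof.
move=> TB Tu vu; apply: xget_unique => // y [Ty vy].
apply/eqP; rewrite -subr_eq0; apply/eqP/dot_eq0.
have := vu _ (TB _ _ Ty Tu); have := vy _ (TB _ _ Ty Tu).
rewrite !(dotE, mxE) => h1 h2; lra.
Qed.

(** If [a x b = 0], expanding [b x (a x b)] gives the relation [|b|^2 a - <b, a> b = 0], so
    independence yields [b = 0], which is itself a dependence. *)
Lemma cross_neq0 a b :
  (forall k l : R, k *: a - l *: b = 0 -> k = 0 /\ l = 0) -> cross a b != 0.
Proof.
move=> indep; apply/eqP => ab0.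
have : cross b (cross a b) = 0 by rewrite ab0 crossr0.
rewrite cross_crossr => /indep[/dot_eq0 b0 _].
have [|_ /eqP] := indep 0 1; first by rewrite b0 scale0r scaler0 subr0.
by rewrite oner_eq0.
Qed.

(** The double product [n x (a x b)] vanishes because [n] is orthogonal to both factors; crossing
    with [n] once more isolates the component along [n]. *)
Lemma unit_orth_cross n a b : dot n n = 1 -> dot n a = 0 -> dot n b = 0 ->
  cross a b = dot n (cross a b) *: n.
Proof.
move=> n1 na nb.
have : cross n (cross n (cross a b)) = 0.
  by rewrite (cross_crossr n a b) na nb !scale0r subr0 crossr0.
by rewrite cross_crossr n1 scale1r => /eqP; rewrite subr_eq0 => /eqP/esym.
Qed.

Lemma dot_cross_unit_sqr n a b : dot n n = 1 -> dot n a = 0 -> dot n b = 0 ->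
  dot n (cross a b) ^+ 2 = dot (cross a b) (cross a b).
Proof.
move=> n1 na nb; rewrite [in RHS](unit_orth_cross n1 na nb).
by rewrite dotZl dotZr n1 mulr1 expr2.
Qed.

(** Both [<n, a x b>] and [<n', a x b>] are the positive square root of [|a x b|^2]; calling it [k],
    one has [k n = a x b = k n']. *)
Lemma unit_normal_uniq n n' a b :
  dot n n = 1 -> dot n a = 0 -> dot n b = 0 -> 0 < dot n (cross a b) ->
  dot n' n' = 1 -> dot n' a = 0 -> dot n' b = 0 -> 0 < dot n' (cross a b) ->
  n = n'.
Proof.
move=> n1 na nb np n1' na' nb' np'.
have e : dot n (cross a b) = dot n' (cross a b).
  apply: (pexpIrn (_ : (0 < 2)%N)) => //; rewrite ?nnegrE ?ltW //.
  by rewrite !dot_cross_unit_sqr.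
have := unit_orth_cross n1 na nb; rewrite {1}(unit_orth_cross n1' na' nb') -e.
by move/(scalerI (lt0r_neq0 np)).
Qed.

(* [rot1 t h] is [1 + t [h x]], the linear part of an infinitesimally isometric
   deformation, and [cof1 t h] is its cofactor matrix. *)
Definition rot1 (t : R) h u : 'rV[R]_3 := u + t *: cross h u.

Definition cof1 (t : R) h u : 'rV[R]_3 :=
  u + t *: cross h u + (t ^+ 2 * dot h u) *: h.

Lemma rot1_inj t h u v : rot1 t h u = rot1 t h v -> u = v.
Proof.
rewrite /rot1 => e; apply/eqP; rewrite -subr_eq0; apply/eqP; apply: dot_eq0.
have : dot (u - v) (u + t *: cross h u) = dot (u - v) (v + t *: cross h v).
  by rewrite e.
by rewrite !(dotE, crossE, mxE) => e'; lra.
Qed.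

Lemma cross_rot1 t h u v :
  cross (rot1 t h u) (rot1 t h v) = cof1 t h (cross u v).
Proof. by apply: row3P; rewrite /rot1 /cof1 !(dotE, crossE, mxE); ring. Qed.

Lemma dot_cof1_rot1 t h u v :
  dot (cof1 t h u) (rot1 t h v) = (1 + t ^+ 2 * dot h h) * dot u v.
Proof. by rewrite /rot1 /cof1 !(dotE, crossE, mxE); ring. Qed.

(** As [h x] is skew, transposing the cofactor matrix replaces [t] by [-t], so [cof1 (- t) h] is the
    adjugate of [rot1 t h]; the scalar is the determinant. *)
Lemma rot1_cof1 t h u :
  rot1 t h (cof1 (- t) h u) = (1 + t ^+ 2 * dot h h) *: u.
Proof. by apply: row3P; rewrite /rot1 /cof1 !(dotE, crossE, mxE); ring. Qed.

Lemma dot_cof1N t h u v : dot u (cof1 (- t) h v) = dot (cof1 t h u) v.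
Proof. by rewrite /cof1 !(dotE, crossE, mxE); ring. Qed.

Lemma rot1Z t h k u : rot1 t h (k *: u) = k *: rot1 t h u.
Proof. by rewrite /rot1 crossZr scalerDr !scalerA mulrC. Qed.

Lemma dot_cof1_sqr t h u : dot (cof1 t h u) (cof1 t h u) =
  (1 + t ^+ 2 * dot h h) * (dot u u + t ^+ 2 * dot h u ^+ 2).
Proof. by rewrite /cof1 !(dotE, crossE, mxE); ring. Qed.

Lemma cof1Z t h k u : cof1 t h (k *: u) = k *: cof1 t h u.
Proof. by apply: row3P; rewrite /cof1 !(dotE, crossE, mxE); ring. Qed.

End VectorAlgebra.

(** * Symmetry of second derivatives *)

Section MixedDerivatives.
Variable R : realType.

(** An equality of the quotients as functions lets both the existence and the value of the
    derivative pass to the line by rewriting. *)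
Lemma line_growth_rate (V W : normedModType R) (F : V -> W) (a v : V) (r : R) :
  (fun h : R => h^-1 *: (((fun s : R => F (s *: v + a)) \o shift r) (h *: 1)
     - F (r *: v + a))) =
  (fun h : R => h^-1 *: ((F \o shift (r *: v + a)) (h *: v) - F (r *: v + a))).
Proof.
apply/funext => h /=; congr (_ *: (F _ - _)).
by rewrite [_%:A]mulr1 scalerDl addrA.
Qed.

Lemma derive_line (V W : normedModType R) (F : V -> W) (a v : V) (r : R) :
  'D_1 (fun s : R => F (s *: v + a)) r = 'D_v F (r *: v + a).
Proof. by rewrite /derive line_growth_rate. Qed.

Lemma derivable_line (V W : normedModType R) (F : V -> W) (a v : V) (r : R) :
  derivable F (r *: v + a) v -> derivable (fun s : R => F (s *: v + a)) r 1.
Proof. by rewrite /derivable line_growth_rate. Qed.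

Lemma is_derive_line (V W : normedModType R) (F : V -> W) (a v : V) (r : R) :
  differentiable F (r *: v + a) ->
  is_derive r 1 (fun s : R => F (s *: v + a)) ('D_v F (r *: v + a)).
Proof.
move=> dF; apply: DeriveDef; last exact: derive_line.
exact/derivable_line/diff_derivable.
Qed.

Lemma MVT_line (V : normedModType R) (F : V -> R) (a v : V) (h : R) : 0 < h ->
  (forall r, 0 <= r <= h -> differentiable F (r *: v + a)) ->
  exists2 c, 0 < c < h & F (h *: v + a) - F a = h * 'D_v F (c *: v + a).
Proof.
move=> h0 dF; pose g (s : R) := F (s *: v + a).
have dg r : 0 <= r <= h -> is_derive r 1 g ('D_v F (r *: v + a)).
  by move=> /dF; exact: is_derive_line.
have [||c] := @MVT R g (fun r => 'D_v F (r *: v + a)) 0 h h0.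
- by move=> r; rewrite in_itv/= => /andP[r0 rh]; apply: dg; rewrite !ltW.
- apply: derivable_within_continuous => r; rewrite in_itv/= => /dg dr.
  exact: ex_derive.
rewrite in_itv/= => ch; rewrite /g scale0r add0r subr0 mulrC => e.
by exists c.
Qed.

(** The mean value theorem is applied twice: along [v] to the increment of [f] in the direction [w],
    then along [w] to [fv]. *)
Lemma second_difference (V : normedModType R) (U : set V) (f fv fvw : V -> R)
    (u v w : V) (h : R) : 0 < h ->
  (forall x, U x -> differentiable f x) ->
  (forall x, U x -> 'D_v f x = fv x) ->
  (forall x, U x -> differentiable fv x) ->
  (forall x, U x -> 'D_w fv x = fvw x) ->
  (forall r s, 0 <= r <= h -> 0 <= s <= h -> U (s *: w + (r *: v + u))) ->
  exists c d, [/\ 0 < c < h, 0 < d < h &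
    f (h *: w + (h *: v + u)) - f (h *: v + u) - f (h *: w + u) + f u =
    h * h * fvw (d *: w + (c *: v + u))].
Proof.
move=> h0 df fvE dfv fvwE hU.
have hh : 0 <= h <= h by rewrite lexx ltW.
have h00 : (0:R) <= 0 <= h by rewrite lexx ltW.
have U0 r : 0 <= r <= h -> U (r *: v + u).
  by move=> /hU/(_ h00); rewrite scale0r add0r.
pose G x := f (x + h *: w) - f x.
have shE (r : R) : r *: v + u + h *: w = h *: w + (r *: v + u) by rewrite addrC.
have dG1 r : 0 <= r <= h ->
    differentiable (fun x => f (x + h *: w)) (r *: v + u).
  move=> rh; apply: (@differentiable_comp _ _ _ _ (fun x => x + h *: w) f).
    exact: differentiableD.
  by apply: df; rewrite shE; apply: hU.
have dG r : 0 <= r <= h -> differentiable G (r *: v + u).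
  by move=> rh; apply: differentiableB; [exact: dG1|by apply: df; apply: U0].
have [c /andP[c0 ch] e1] := MVT_line h0 dG.
have c0h : 0 <= c <= h by rewrite !ltW.
have [|d /andP[d0 dh] e2] := @MVT_line V fv (c *: v + u) w h h0.
  by move=> s sh; apply: dfv; apply: hU.
exists c, d; split; rewrite ?c0 ?d0//.
have d0h : 0 <= d <= h by rewrite !ltW.
rewrite fvwE in e2; last exact: hU.
rewrite -mulrA -e2.
have <- : 'D_v G (c *: v + u) = fv (h *: w + (c *: v + u)) - fv (c *: v + u).
  rewrite deriveB; [|by apply: diff_derivable; apply: dG1
    |by apply: diff_derivable; apply: df; apply: U0].
  rewrite -!fvE; [|exact: U0|exact: hU].
  (* Translating the argument by [h *: w] turns the difference quotient into that of [f] at the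
     translated point. *)
  congr (_ - _); apply: (congr1 (fun g : R -> R => lim (g @ 0^'))).
  by apply/funext => t /=; rewrite shE -addrA shE.
rewrite -e1 /G shE (addrC u); ring.
Qed.

Lemma ball_parallelogram (V : normedModType R) (u v w : V) (A : set V) :
  nbhs u A -> exists2 h, 0 < h & forall r s, 0 <= r <= h -> 0 <= s <= h ->
    A (s *: w + (r *: v + u)).
Proof.
move=> /nbhs_ballP[e /= e0 eA].
have k0 : 0 < `|v| + `|w| + 1 by rewrite ltr_pwDr// addr_ge0.
(* This size keeps [|s w + r v|] at most [e / 2]; the summand [1] keeps the denominator positive
   when [v = w = 0]. *)
exists (e / 2 / (`|v| + `|w| + 1)); first by rewrite !divr_gt0.
move=> r s /andP[r0 rh] /andP[s0 sh]; apply: eA.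
rewrite -ball_normE /= addrA opprD addrCA subrr addr0 normrN.
rewrite (le_lt_trans (ler_normD _ _))// !normrZ !ger0_norm//.
apply: (@le_lt_trans _ _ (e / 2)); last first.
  by rewrite ltr_pdivrMr// ltr_pMr// ltr1n.
move: rh sh; rewrite !ler_pdivlMr// => rh sh.
have := normr_ge0 v; have := normr_ge0 w; nra.
Qed.

(* Both mixed derivatives are limits of the same second difference quotient. *)
Lemma derive_mixedC (V : normedModType R) (U : set V) (f fv fw fvw fwv : V -> R)
    (u v w : V) : open U -> U u ->
  (forall x, U x -> differentiable f x) ->
  (forall x, U x -> 'D_v f x = fv x) -> (forall x, U x -> 'D_w f x = fw x) ->
  (forall x, U x -> differentiable fv x) ->
  (forall x, U x -> differentiable fw x) ->
  (forall x, U x -> 'D_w fv x = fvw x) ->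
  (forall x, U x -> 'D_v fw x = fwv x) ->
  {for u, continuous fvw} -> {for u, continuous fwv} -> fvw u = fwv u.
Proof.
move=> oU Uu df fvE fwE dfv dfw fvwE fwvE cvw cwv.
apply/eqP; rewrite -subr_eq0 -normr_le0; apply/ler_addgt0Pl => e e0.
rewrite addr0.
have e20 : 0 < e / 2 by rewrite divr_gt0.
have nA : nbhs u (U `&` [set x | `|fvw u - fvw x| < e / 2] `&`
             [set x | `|fwv u - fwv x| < e / 2]).
  apply: filterI; [apply: filterI|].
  - exact: open_nbhs_nbhs.
  - by move/cvgrPdist_lt : cvw; apply.
  - by move/cvgrPdist_lt : cwv; apply.
have [h h0 hA] := ball_parallelogram v w nA.
have [|c [d [/andP[c0 ch] /andP[d0 dh] e1]]] :=
    second_difference (u := u) h0 df fvE dfv fvwE.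
  by move=> r s rh sh; case: (hA r s rh sh) => -[].
have [|c' [d' [/andP[c0' ch'] /andP[d0' dh'] e2]]] :=
    second_difference (u := u) h0 df fwE dfw fwvE.
  move=> r s rh sh; case: (hA s r sh rh) => -[+ _ _].
  by rewrite addrCA.
have [||[_ a1] _] := hA c d; rewrite ?c0 ?d0 ?ltW//.
have [||[_ _] a2] := hA d' c'; rewrite ?c0' ?d0' ?ltW//.
rewrite /= in a1; rewrite /= addrCA in a2.
have hh : h * h != 0 by rewrite mulf_neq0// gt_eqF.
(* The left sides of [e1] and [e2] are the same second difference with the two middle terms
   exchanged. *)
have E : fvw (d *: w + (c *: v + u)) = fwv (d' *: v + (c' *: w + u)).
  by apply: (mulfI hh); rewrite -e1 -e2 (addrCA (h *: v)); ring.
apply: (le_lt_trans (ler_distD (fvw (d *: w + (c *: v + u))) _ _)).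
by rewrite (splitr e) ltrD// E distrC.
Qed.

Lemma derive_coord (V : normedModType R) n (F : V -> 'rV[R]_n) (u v : V) i :
  differentiable F u -> 'D_v F u 0 i = 'D_v (fun x => F x 0 i) u.
Proof. by move=> /diff_derivable dF; rewrite derive_mx// mxE. Qed.

Lemma differentiable_coord_comp (V : normedModType R) n (F : V -> 'rV[R]_n)
    (u : V) i : differentiable F u -> differentiable (fun x => F x 0 i) u.
Proof.
move=> dF; apply: (@differentiable_comp _ _ _ _ F (fun M => M 0 i)) => //.
exact: differentiable_coord.
Qed.

Lemma smooth_derive_mixedC (V : normedModType R) n (U : set V)
    (F : V -> 'rV[R]_n) (u v w : V) : open U -> U u -> smooth_on U F ->
  'D_w (fun y => 'D_v F y) u = 'D_v (fun y => 'D_w F y) u.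
Proof.
move=> oU Uu sF.
have dF x : U x -> differentiable F x by case: (sF 1%N) => + _; apply.
have dF1 z x : U x -> differentiable (fun y => 'D_z F y) x.
  by case: (sF 2%N) => _ /(_ z)[+ _]; apply.
have cF i z z' :
    {for u, continuous (fun x => 'D_z' (fun y => 'D_z F y) x 0 i)}.
  case: (sF 2%N) => _ /(_ z)[_ /(_ z')] /(_ _ Uu) cF.
  apply: (@continuous_comp _ _ _ (fun x => 'D_z' (fun y => 'D_z F y) x)
    (fun M : 'rV[R]_n => M 0 i)) => //.
  exact: coord_continuous.
apply/rowP => i.
apply: (@derive_mixedC _ U (fun x => F x 0 i) (fun y => 'D_v F y 0 i)
  (fun y => 'D_w F y 0 i) (fun x => 'D_w (fun y => 'D_v F y) x 0 i)
  (fun x => 'D_v (fun y => 'D_w F y) x 0 i) u v w oU Uu) => // x Ux.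
- by apply: differentiable_coord_comp; apply: dF.
- by rewrite derive_coord//; apply: dF.
- by rewrite derive_coord//; apply: dF.
- by apply: differentiable_coord_comp; apply: dF1.
- by apply: differentiable_coord_comp; apply: dF1.
- by rewrite derive_coord//; apply: dF1.
- by rewrite derive_coord//; apply: dF1.
Qed.

End MixedDerivatives.

(** * Calculus of row vectors *)

Section RowCalculus.
Variable R : realType.
Variable V : normedModType R.
Implicit Types (u v : V).

Lemma differentiable_row n (F : V -> 'rV[R]_n) u :
  (forall i, differentiable (fun x => F x 0 i) u) -> differentiable F u.
Proof.
move=> dF; have -> : F = \sum_i (fun x => F x 0 i *: delta_mx 0 i).
  by apply/funext => x; rewrite fct_sumE {1}[F x]row_sum_delta.
by apply: differentiable_sum => i; apply: differentiableZl.
Qed.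

Lemma differentiable_scale n (k : V -> R) (F : V -> 'rV[R]_n) u :
  differentiable k u -> differentiable F u ->
  differentiable (fun x => k x *: F x) u.
Proof.
move=> dk dF; apply: differentiable_row => i.
under eq_fun do rewrite mxE.
by apply: differentiableM => //; apply: differentiable_coord_comp.
Qed.

Lemma derive_scale n (k : V -> R) (F : V -> 'rV[R]_n) u v :
  differentiable k u -> differentiable F u ->
  'D_v (fun x => k x *: F x) u = 'D_v k u *: F u + k u *: 'D_v F u.
Proof.
move=> dk dF; apply/rowP => i.
rewrite derive_coord; last exact: differentiable_scale.
under eq_fun do rewrite mxE.
rewrite deriveM; [|exact: diff_derivable|].
  by rewrite !mxE derive_coord// addrC; congr (_ + _); rewrite [_ *: _]mulrC.
by apply/diff_derivable/differentiable_coord_comp.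
Qed.

Lemma differentiable_dot (F G : V -> 'rV[R]_3) u :
  differentiable F u -> differentiable G u ->
  differentiable (fun x => dot (F x) (G x)) u.
Proof.
move=> dF dG; under eq_fun do rewrite dotE.
apply: differentiableD; first apply: differentiableD.
all: by apply: differentiableM; apply: differentiable_coord_comp.
Qed.

Lemma derive_dot (F G : V -> 'rV[R]_3) u v :
  differentiable F u -> differentiable G u ->
  'D_v (fun x => dot (F x) (G x)) u =
  dot ('D_v F u) (G u) + dot (F u) ('D_v G u).
Proof.
move=> dF dG; under eq_fun do rewrite dotE.
have dc (H : V -> 'rV[R]_3) i : differentiable H u ->
    derivable (fun x => H x 0 i) u v.
  by move=> dH; apply/diff_derivable/differentiable_coord_comp.
have dm i : derivable (fun x => F x 0 i * G x 0 i) u v.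
  by apply: derivableM; apply: dc.
rewrite (deriveD (derivableD (dm 0) (dm 1)) (dm 2)) (deriveD (dm 0) (dm 1)).
rewrite !deriveM; [|exact: dc..].
rewrite !dotE !derive_coord//.
rewrite /GRing.scale /=; ring.
Qed.

Lemma differentiable_cross (F G : V -> 'rV[R]_3) u :
  differentiable F u -> differentiable G u ->
  differentiable (fun x => cross (F x) (G x)) u.
Proof.
move=> dF dG; apply: differentiable_row => i; under eq_fun do rewrite mxE.
by apply: differentiableB; apply: differentiableM;
  apply: differentiable_coord_comp.
Qed.

Lemma derive_cross (F G : V -> 'rV[R]_3) u v :
  differentiable F u -> differentiable G u ->
  'D_v (fun x => cross (F x) (G x)) u =
  cross ('D_v F u) (G u) + cross (F u) ('D_v G u).
Proof.
move=> dF dG; apply/rowP => i.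
rewrite derive_coord; last exact: differentiable_cross.
under eq_fun do rewrite mxE.
have dc (H : V -> 'rV[R]_3) j : differentiable H u ->
    derivable (fun x => H x 0 j) u v.
  by move=> dH; apply/diff_derivable/differentiable_coord_comp.
rewrite deriveB; [|by apply: derivableM; apply: dc..].
rewrite !deriveM; [|exact: dc..].
rewrite !mxE !derive_coord// /GRing.scale /=; ring.
Qed.

Lemma cvg_coord (T : Type) (F : set_system T) {FF : Filter F} n
    (f : T -> 'rV[R]_n) (a : 'rV[R]_n) :
  f @ F --> a -> forall i, (fun x => f x 0 i) @ F --> a 0 i.
Proof.
move=> fa i; apply: (@cvg_comp _ _ _ f (fun M : 'rV[R]_n => M 0 i) _ _ _ fa).
exact: coord_continuous.
Qed.

Lemma cvg_row (T : Type) (F : set_system T) {FF : Filter F} n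
    (f : T -> 'rV[R]_n) (a : 'rV[R]_n) :
  (forall i, (fun x => f x 0 i) @ F --> a 0 i) -> f @ F --> a.
Proof.
move=> fa; rewrite [a]row_sum_delta.
have -> : f = fun x => \sum_i f x 0 i *: delta_mx 0 i.
  by apply/funext => x; rewrite {1}[f x]row_sum_delta.
apply: cvg_big => [|i _]; first exact: add_continuous.
by apply: cvgZr_tmp; exact: fa.
Qed.

Lemma cvg_cross (T : Type) (F : set_system T) {FF : Filter F}
    (f g : T -> 'rV[R]_3) (a b : 'rV[R]_3) :
  f @ F --> a -> g @ F --> b ->
  (fun x => cross (f x) (g x)) @ F --> cross a b.
Proof.
move=> fa gb; apply: cvg_row => i; rewrite mxE.
under eq_fun do rewrite mxE.
by apply: cvgB; apply: cvgM; apply: cvg_coord.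
Qed.

Lemma cvg_dot (T : Type) (F : set_system T) {FF : Filter F}
    (f g : T -> 'rV[R]_3) (a b : 'rV[R]_3) :
  f @ F --> a -> g @ F --> b ->
  (fun x => dot (f x) (g x)) @ F --> dot a b.
Proof.
move=> fa gb; rewrite dotE; under eq_fun do rewrite dotE.
apply: cvgD; first apply: cvgD.
all: by apply: cvgM; apply: cvg_coord.
Qed.

End RowCalculus.

(** * Change of charts *)

Section Charts.
Variable R : realType.

(* If [G] is tangent to the identity at [y 0] and [G \o y] is derivable, so is
   [y]: the error of the linearisation is absorbed into [y] itself. *)
Lemma derivable_of_tangent_id (V : normedModType R) (G : V -> V) (a : V)
    (y z : R -> V) : differentiable G a -> 'd G a = id :> (V -> V) ->
  y 0 = a -> {for 0, continuous y} ->
  (\forall t \near (0 : R), z t = G (y t)) ->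
  derivable z 0 1 -> is_derive (0 : R) 1 y ('D_1 z 0).
Proof.
move=> dG dGid y0 cy zG dz.
suff H : (fun h : R => h^-1 *: ((y \o shift 0) (h *: 1) - y 0)) @ 0^' -->
    'D_1 z 0.
  by apply: DeriveDef; [apply/cvg_ex; eexists; exact: H|exact: cvg_lim].
have qz : (fun h : R => h^-1 *: ((z \o shift 0) (h *: 1) - z 0)) @ 0^' -->
    'D_1 z 0.
  exact: dz.
set l := 'D_1 z 0 in qz *.
apply/cvgrPdist_le => e e0.
set L := `|l| + 1; have L0 : 0 < L by rewrite ltr_pwDr.
(* The bound [1 / 2] lets the linearisation error be absorbed into the increment of [y]; the bound
   [e / (4 L)] makes the final error [2 d L] at most [e / 2]. [L] will bound the difference
   quotients of [z] near [0]. *)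
set d := Num.min (1 / 2) (e / (4 * L)).
have d0 : 0 < d by rewrite lt_min !divr_gt0 ?mulr_gt0.
have rho : \forall t \near (0 : R),
    `|G (y t) - G a - (y t - a)| <= d * `|y t - a|.
  have h1 := diff_locallyxC dG.
  have h2 : \forall h \near (0 : V), `|G (a + h) - G a - h| <= d * `|h|.
    near=> h; rewrite h1 dGid -addrA -opprD (addrAC (G a + h)) subrr add0r.
    by near: h; apply: littleoP.
  have cy0 : (y t - a) @[t --> (0:R)] --> (0 : V).
    by rewrite -(subrr a) -{2}y0; apply: cvgB; [exact: cy|exact: cvg_cst].
  have := cy0 _ h2; rewrite !near_simpl /=; apply: filterS => t /=.
  by rewrite addrCA subrr addr0.
have rho' := nbhs_dnbhs rho.
have zG' := nbhs_dnbhs zG.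
have z0 : z 0 = G a by rewrite (nbhs_singleton zG) /= y0.
near=> t.
have t0 : t != 0 by near: t; exact: nbhs_dnbhs_neq.
have ht : `|G (y t) - G a - (y t - a)| <= d * `|y t - a|.
  by near: t; exact: rho'.
have zt : z t = G (y t) by near: t; exact: zG'.
have q1 : `|l - t^-1 *: (z t - z 0)| <= e / 2.
  near: t; move/cvgrPdist_le : qz => /(_ (e / 2)).
  rewrite divr_gt0// => /(_ isT).
  by apply: filterS => t /=; rewrite [t *: 1]mulr1 addr0.
have q2 : `|l - t^-1 *: (z t - z 0)| <= 1.
  near: t; move/cvgrPdist_le : qz => /(_ 1); rewrite ltr01 => /(_ isT).
  by apply: filterS => t /=; rewrite [t *: 1]mulr1 addr0.
rewrite /= [t *: 1]mulr1 addr0 y0.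
rewrite zt z0 in q1 q2.
set g := G (y t) - G a in ht q1 q2; set dl := y t - a in ht *.
have nt : 0 < `|t| by rewrite normr_gt0.
have hd1 : d <= 1 / 2 by rewrite ge_min lexx.
have hd2 : d * (4 * L) <= e.
  by rewrite -ler_pdivlMr ?mulr_gt0// ge_min lexx orbT.
(* Absorption: [|dl| <= |g| + d |dl| <= |g| + |dl| / 2]. *)
have dlg : `|dl| <= 2 * `|g|.
  have : `|dl| <= `|g| + `|g - dl|.
    by rewrite -[X in `|X| <= _](subKr g) ler_normB.
  have := normr_ge0 dl; nra.
have gL : `|t^-1 *: g| <= L.
  rewrite -[X in `|X| <= _](subKr l) (le_trans (ler_normB _ _))//.
  by rewrite lerD2l.
have -> : l - t^-1 *: dl = (l - t^-1 *: g) + t^-1 *: (g - dl).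
  by rewrite [t^-1 *: (g - dl)]scalerBr addrA subrK.
rewrite (le_trans (ler_normD _ _))// (splitr e) lerD//.
move: gL; rewrite !normrZ normfV => gL.
have : `|t|^-1 * `|g - dl| <= `|t|^-1 * (d * (2 * `|g|)).
  rewrite ler_wpM2l ?invr_ge0//; apply: (le_trans ht).
  by rewrite ler_wpM2l// ltW.
move/le_trans; apply.
have -> : `|t|^-1 * (d * (2 * `|g|)) = 2 * d * (`|t|^-1 * `|g|) by ring.
apply: (@le_trans _ _ (2 * d * L)); first by rewrite ler_wpM2l// mulr_ge0// ltW.
rewrite ler_pdivlMr//; apply: le_trans hd2; rewrite le_eqVlt; apply/orP; left.
by apply/eqP; ring.
Unshelve. all: by end_near. Qed.

(** Vectors are rows, so an injective differential means a row-free Jacobian, and a right inverse of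
    that matrix undoes the differential. *)
Lemma diff_inj_linv n m (g : 'rV[R]_n -> 'rV[R]_m)
    (u : 'rV[R]_n) :
  differentiable g u -> (forall v, 'D_v g u = 0 -> v = 0) ->
  exists B : 'M[R]_(m, n), forall v, 'D_v g u *m B = v.
Proof.
move=> dg inj; have : row_free (jacobian g u).
  by apply/inj_row_free => v; rewrite -deriveEjacobian//; exact: inj.
move=> /row_freeP[B JB]; exists B => v.
by rewrite deriveEjacobian// -mulmxA JB mulmx1.
Qed.

Lemma differentiable_mulmxr (E : normedModType R) n m (h : E -> 'rV[R]_n)
    (B : 'M[R]_(n, m)) (u v : E) : differentiable h u ->
  differentiable (fun x => h x *m B) u /\
  'D_v (fun x => h x *m B) u = 'D_v h u *m B.
Proof.
move=> dh.
have cB : continuous (mulmxr B : 'rV[R]_n -> 'rV[R]_m).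
  move=> a; apply: (@cvg_row _ _ (nbhs a)) => i; rewrite mxE.
  under eq_fun do rewrite mxE.
  apply: cvg_big => [|j _]; first exact: add_continuous.
  by apply: cvgM; [exact: coord_continuous|exact: cvg_cst].
have dB a : differentiable (mulmxr B : 'rV[R]_n -> 'rV[R]_m) a.
  exact: linear_differentiable.
have dc : differentiable (mulmxr B \o h) u by exact: differentiable_comp.
split => //; rewrite -[fun x => h x *m B]/(mulmxr B \o h).
by rewrite deriveE// diff_comp//= diff_lin//= deriveE.
Qed.

Implicit Types (M W : set 'rV[R]_3) (U V : set 'rV[R]_2).
Implicit Types (u v w : 'rV[R]_2) (f g : 'rV[R]_2 -> 'rV[R]_3).
Implicit Types (F : 'rV[R]_3 -> 'rV[R]_3).

Lemma Ck_sub (E E' : normedModType R) k (A B : set E) (h : E -> E') :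
  B `<=` A -> Ck k A h -> Ck k B h.
Proof.
move=> BA; elim: k h => [|k IH] h /=; first by move=> c x /BA; exact: c.
by move=> [d c]; split=> [x /BA|v]; [exact: d|exact: IH].
Qed.

Lemma smooth_differentiable (E E' : normedModType R) (A : set E)
    (h : E -> E') x :
  smooth_on A h -> A x -> differentiable h x.
Proof. by move=> /(_ 1%N)[+ _]; apply. Qed.

Lemma chart_differentiable M U f u : chart M U f -> U u -> differentiable f u.
Proof. by move=> [_ sf _ _ _]; exact: smooth_differentiable sf. Qed.

Lemma chart_mem M U f u : chart M U f -> U u -> M (f u).
Proof.
move=> [oU _ _ _ /(_ U oU (@subset_refl _ U))[W [_ fU]]] Uu.
have : (f @` U) (f u) by exists u.
by rewrite fU => -[].
Qed.

Lemma open_chart_preimage M U f W : chart M U f -> open W ->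
  open (U `&` f @^-1` W).
Proof.
move=> cf oW; rewrite openE => u [Uu Wu]; apply: filterI.
  by apply: open_nbhs_nbhs; split => //; case: cf.
apply: (differentiable_continuous (chart_differentiable cf Uu)).
exact: open_nbhs_nbhs.
Qed.

Lemma chart_restrict M U f W : chart M U f -> open W ->
  chart M (U `&` f @^-1` W) f.
Proof.
move=> cf oW; have oUW := open_chart_preimage cf oW.
case: cf => oU sf inj1 inj2 op; split => //.
- by move=> k; apply: Ck_sub (sf k) => u [].
- by move=> u v [Uu _]; exact: inj1.
- by move=> u u' [Uu _] [Uu' _]; exact: inj2.
- by move=> U' oU' U'U; apply: op => // u /U'U[].
Qed.

Lemma chart_restrict_sub M U f W : chart M U f -> open W ->
  chart (M `&` W) (U `&` f @^-1` W) f.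
Proof.
move=> cf oW; case: (chart_restrict cf oW) => oU sf inj1 inj2 op; split => //.
move=> U' oU' U'U; have [W' [oW' fU']] := op U' oU' U'U.
exists W'; split => //; rewrite fU' -setIA [W `&` _]setIC setIA -fU'.
apply/seteqP; split => [x [u U'u <-]|x []//].
by split; [exists u|case: (U'U _ U'u)].
Qed.

(** A straight line in one chart is read in the other. Only continuity of the lift is obtained here,
    from [g] being open onto its image in [M]. *)
Lemma chart_lift M U f V g u u' v : chart M U f -> U u -> chart M V g -> V u' ->
  f u = g u' -> exists y : R -> 'rV[R]_2, [/\ y 0 = u', {for 0, continuous y} &
    \forall t \near (0 : R), f (t *: v + u) = g (y t)].
Proof.
move=> cf Uu cg Vu' fg.
(* The default [u'] is taken only where no lift exists, which does not happen near [0]; injectivity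
   of [g] makes the lift unique. *)
pose y (t : R) := xget u' [set p | V p /\ g p = f (t *: v + u)].
have yE t p : V p -> g p = f (t *: v + u) -> y t = p.
  move=> Vp gp; apply: xget_unique => // q [Vq gq].
  by case: cg => _ _ _ + _; apply => //; rewrite gq.
have y0 : y 0 = u' by apply: yE => //; rewrite scale0r add0r.
have lift (A : set 'rV[R]_2) : nbhs u' A ->
    \forall t \near (0 : R), A (y t) /\ f (t *: v + u) = g (y t).
  move=> nA.
  (* The image of this open set under [g] is cut out of [M] by an open [W'], in which the line stays
     for small [t]. *)
  have oV' : open (V `&` A^°) by apply: openI; [case: cg|exact: open_interior].
  have [W' [oW' gV']] : exists W', open W' /\ g @` (V `&` A^°) = M `&` W'.
    by case: cg => _ _ _ _; apply => // p [].
  have line0 : (fun t : R => t *: v + u) @ 0 --> u.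
    rewrite -{2}[u]add0r -(scale0r v).
    by apply: cvgD; [apply: cvgZr_tmp|exact: cvg_cst].
  have : nbhs u (U `&` f @^-1` W').
    apply: open_nbhs_nbhs; split; first exact: open_chart_preimage cf _.
    split=> //=; rewrite fg.
    have : (g @` (V `&` A^°)) (g u') by exists u'.
    by rewrite gV' => -[].
  move/line0; rewrite !near_simpl /=; apply: filterS => t [/= Ut W't].
  have : (M `&` W') (f (t *: v + u)) by split => //; exact: chart_mem cf Ut.
  rewrite -gV' => -[p [Vp Ap] gp].
  by rewrite (yE t p Vp gp) gp; split => //; exact: interior_subset.
exists y; split => //.
- by move=> A; rewrite y0 => /lift; rewrite nbhs_simpl /=;
  apply: filterS => t [].
- by apply: filterS (lift setT filterT) => t [].
Qed.

(** The direction [w] is the velocity at [0] of the lifted line, and the chain rule does the rest.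
    It is chosen before [F], so that [F = id] also identifies the tangent vectors themselves. *)
Lemma chart_change M U f V g u u' v :
  chart M U f -> U u -> chart M V g -> V u' ->
  f u = g u' -> exists w, forall F, differentiable (F \o g) u' ->
    'D_v (F \o f) u = 'D_w (F \o g) u'.
Proof.
move=> cf Uu cg Vu' fg.
have [y [y0 cy fgy]] := chart_lift v cf Uu cg Vu' fg.
have dg := chart_differentiable cg Vu'.
have df := chart_differentiable cf Uu.
have [B gB] : exists B : 'M[R]_(3, 2), forall v, 'D_v g u' *m B = v.
  by apply: diff_inj_linv => // w; case: cg => _ _ + _ _; exact.
have dc : differentiable (fun t : R => f (t *: v + u)) 0.
  apply/derivable1_diffP/derivable_line/diff_derivable.
  by rewrite scale0r add0r.
have dy : is_derive (0 : R) 1 y ('D_1 (fun t : R => f (t *: v + u) *m B) 0).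
  (* Multiplying by the left inverse [B] makes the differential of [g] at [u'] the identity, so the
     velocity of [y] can be read off from [f (t *: v + u) *m B]. *)
  apply: (@derivable_of_tangent_id _ (fun p => g p *m B) u' y) => //.
  - by have [] := differentiable_mulmxr B 0 dg.
  - apply/funext => w; have [d e] := differentiable_mulmxr B w dg.
    by rewrite -deriveE// e.
  - by apply: filterS fgy => t /= ->.
  - by apply/derivable1_diffP; have [] := differentiable_mulmxr B 0 dc.
exists ('D_1 y 0) => F dF.
have -> : 'D_v (F \o f) u = 'D_1 (fun t : R => (F \o f) (t *: v + u)) 0.
  by rewrite derive_line scale0r add0r.
have -> : 'D_1 (fun t : R => (F \o f) (t *: v + u)) 0 = 'D_1 ((F \o g) \o y) 0.
  by apply: near_eq_derive; apply: filterS fgy => t /= ->.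
have dy' : differentiable y 0 by apply/derivable1_diffP.
rewrite -y0 in dF *.
have dFy : differentiable ((F \o g) \o y) 0 by exact: differentiable_comp.
by rewrite (deriveE _ dFy) (diff_comp dy' dF) (deriveE _ dF) (deriveE _ dy').
Qed.

Lemma derive_inj M V g u w w' : chart M V g -> V u ->
  'D_w g u = 'D_w' g u -> w = w'.
Proof.
move=> cg Vu; have dg := chart_differentiable cg Vu.
rewrite !deriveE// => /eqP; rewrite -subr_eq0 -linearB -deriveE// => /eqP h.
by apply/eqP; rewrite -subr_eq0; apply/eqP; case: cg => _ _ + _ _; apply; eauto.
Qed.

(** Any competing chart and direction is carried by [chart_change] to a direction [w'] of [g]; the
    case [F = id] shows that [w] and [w'] have the same image, hence agree. *)
Lemma dsurf_chart M V g F u w :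
  chart M V g -> V u -> differentiable (F \o g) u ->
  dsurf M F (g u) ('D_w g u) = 'D_w (F \o g) u.
Proof.
move=> cg Vu dF; apply: xget_unique; first by exists V, g, u, w.
move=> Y [U [f [u' [v [cf Uu' fg Dv ->]]]]].
have [w' hw'] := chart_change v cf Uu' cg Vu fg.
have e : 'D_v f u' = 'D_w' g u by exact: (hw' id (chart_differentiable cg Vu)).
rewrite (hw' F dF); suff -> : w' = w by [].
by apply: (derive_inj cg Vu); rewrite -e.
Qed.

Lemma tangent_derive M V g u w : chart M V g -> V u ->
  tangent M (g u) ('D_w g u).
Proof. by move=> cg Vu; exists V, g, u, w. Qed.

Lemma tangent_chart M V g u : chart M V g -> V u ->
  tangent M (g u) = range (fun w => 'D_w g u).
Proof.
move=> cg Vu; apply/seteqP; split => X.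
  move=> [U [f [u' [v [cf Uu' fg <-]]]]].
  have [w hw] := chart_change v cf Uu' cg Vu fg.
  by exists w => //; apply/esym; exact: (hw id (chart_differentiable cg Vu)).
by move=> [w _ <-]; exact: (tangent_derive w cg Vu).
Qed.

End Charts.

(** * The derivative of the deformed normal *)

Section ShapeLimit.
Variable R : realType.
Variables (h n e b : 'rV[R]_3).
Hypotheses (nn : dot n n = 1) (bn : dot b n = 0).

Let m t := cof1 t h n.
Let a := cross e n + cross h b.
Let r := (dot e n + dot h b) *: h + dot h n *: e.

(* For [e] and [b] the derivatives of [h] and [n] in some direction, [dcof1] is
   the derivative of [cof1 t h n], [dnormal] that of [cof1 t h n] normalised,
   and [dshape] its preimage under [rot1 t h]. *)
Definition dcof1 (t : R) : 'rV[R]_3 :=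
  b + t *: (cross e n + cross h b) +
  t ^+ 2 *: ((dot e n + dot h b) *: h + dot h n *: e).

Definition normal_scale (t : R) : R :=
  (Num.sqrt (dot (cof1 t h n) (cof1 t h n)))^-1.

Definition dnormal (t : R) : 'rV[R]_3 :=
  normal_scale t *: dcof1 t -
  (normal_scale t ^+ 3 * dot (dcof1 t) (cof1 t h n)) *: cof1 t h n.

Definition dshape (t : R) : 'rV[R]_3 :=
  (1 + t ^+ 2 * dot h h)^-1 *: cof1 (- t) h (dnormal t).

(** [q] and [kap] are what remains of [|m t|^2 - 1] and of [<dcof1 t, m t>] after division by [t^2];
    they keep every later quotient free of a division by [t]. *)
Let q t := dot h h + dot h n ^+ 2 + t ^+ 2 * (dot h h * dot h n ^+ 2).
Let kap t := dot b (dot h n *: h) + dot a (cross h n) + dot r n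
  + t * (dot a (dot h n *: h) + dot r (cross h n))
  + t ^+ 2 * dot r (dot h n *: h).
Let sigma t := Num.sqrt (dot (m t) (m t)).

Let DE t : dot (m t) (m t) = 1 + t ^+ 2 * q t.
Proof. by rewrite dot_cof1_sqr nn /q; ring. Qed.

Let D_gt0 t : 0 < dot (m t) (m t).
Proof.
by rewrite dot_cof1_sqr nn mulr_gt0// ltr_pwDl// mulr_ge0// ?sqr_ge0// dot_ge0.
Qed.

Let sigma_gt0 t : 0 < sigma t.
Proof. by rewrite sqrtr_gt0. Qed.

Let dmmE t : dot (dcof1 t) (m t) = t ^+ 2 * kap t.
Proof.
(* The coefficient of [t] is [<b, h x n> + <a, n>], which cancels. *)
have -> : dot (dcof1 t) (m t) = dot b n + t ^+ 2 * kap t.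
  by rewrite /dcof1 /kap /a /r /m /cof1 !(dotE, crossE, mxE); ring.
by rewrite bn add0r.
Qed.

(** The derivative of a unit vector is orthogonal to it. This is what will place the pulled back
    vector in the tangent plane of [M]. *)
Lemma dot_cof1_dnormal t : dot (cof1 t h n) (dnormal t) = 0.
Proof.
rewrite /dnormal dotDr -scaleNr !dotZr [dot (cof1 _ _ _) (dcof1 t)]dotC.
rewrite /normal_scale -[Num.sqrt _]/(sigma t).
have -> : dot (cof1 t h n) (cof1 t h n) = sigma t ^+ 2.
  by rewrite sqr_sqrtr// ltW.
by field; rewrite gt_eqF.
Qed.

(** The quotient [(dnormal t - b) / t] in a form that also makes sense at [t = 0]. *)
Let z1 t := - ((sigma t)^-1 * (t * q t) / (1 + sigma t)) *: b
  + (sigma t)^-1 *: (a + t *: r) - ((sigma t)^-1 ^+ 3 * (t * kap t)) *: m t.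

Let dnormalE t : dnormal t = b + t *: z1 t.
Proof.
have s1 : 1 + sigma t != 0 by rewrite gt_eqF// addr_gt0.
have s0 : sigma t != 0 by rewrite gt_eqF.
(* Rationalising: [sigma - 1 = (sigma^2 - 1) / (1 + sigma)] with [sigma^2 - 1 = t^2 q]. *)
have sE : (sigma t)^-1 = 1 - (sigma t)^-1 * (t ^+ 2 * q t) / (1 + sigma t).
  have -> : t ^+ 2 * q t = sigma t ^+ 2 - 1.
    by rewrite sqr_sqrtr ?ltW// DE addrAC subrr add0r.
  by field; rewrite ?s0 ?s1.
rewrite /dnormal /normal_scale -[Num.sqrt _]/(sigma t) dmmE /dcof1 -/a -/r.
rewrite -/(m t) /z1.
set s := (sigma t)^-1 in sE *; set k := t * q t; set v := 1 + sigma t in sE *.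
have -> : s *: (b + t *: a + t ^+ 2 *: r) =
    s *: b + s *: (t *: a + t ^+ 2 *: r).
  by rewrite -addrA scalerDr.
rewrite [s in s *: b]sE.
have -> : s * (t ^+ 2 * q t) / v = t * (s * k / v) by rewrite /k; ring.
by apply: row3P; rewrite !mxE; ring.
Qed.

Let quot t := (1 + t ^+ 2 * dot h h)^-1 *:
  (z1 t - cross h (dnormal t) + (t * dot h (dnormal t)) *: h
   - (t * dot h h) *: b).

Let quotE (t : R) : t != 0 -> t^-1 *: (dshape t - b) = quot t.
Proof.
move=> t0; have d0 : 1 + t ^+ 2 * dot h h != 0.
  by rewrite gt_eqF// ltr_pwDl// mulr_ge0 ?sqr_ge0// dot_ge0.
rewrite /quot /dshape.
set d := 1 + _ in d0 *.
have bE : d^-1 *: (d *: b) = b by rewrite scalerA mulVf// scale1r.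
rewrite -{1}bE -scalerBr scalerA (mulrC t^-1) -(scalerA d^-1 t^-1).
congr (_ *: _).
rewrite /cof1 {1}dnormalE /d.
set z := z1 t; set w := dnormal t.
have -> : b + t *: z + - t *: cross h w + ((- t) ^+ 2 * dot h w) *: h
    - (1 + t ^+ 2 * dot h h) *: b =
    t *: (z - cross h w + (t * dot h w) *: h - (t * dot h h) *: b).
  by apply: row3P; rewrite !mxE; ring.
by rewrite scalerA mulVf// scale1r.
Qed.

Let cvg_cof1 : cof1 t h n @[t --> (0 : R)] --> n.
Proof.
rewrite [X in _ --> X](_ : n = n + 0 *: cross h n + (0 * 0 * dot h n) *: h);
  last by rewrite !(mul0r, scale0r, addr0).
rewrite /cof1; apply: cvgD; first apply: cvgD; first exact: cvg_cst.
  by apply: cvgZr_tmp; exact: cvg_id.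
apply: cvgZr_tmp; apply: cvgM; last exact: cvg_cst.
by under eq_fun do rewrite expr2; apply: cvgM; exact: cvg_id.
Qed.

Let cvg_sigma : sigma t @[t --> (0 : R)] --> (1 : R).
Proof.
rewrite -(sqrtr1 R) -nn; apply: (@cvg_comp _ _ _ (fun t => dot (m t) (m t))
  Num.sqrt _ (nbhs (dot n n))); last exact: sqrt_continuous.
by apply: cvg_dot; exact: cvg_cof1.
Qed.

Let cvg_t2 : (t : R) ^+ 2 @[t --> (0 : R)] --> (0 : R).
Proof.
rewrite -[X in _ --> X](mulr0 0); under eq_fun do rewrite expr2.
by apply: cvgM; exact: cvg_id.
Qed.

Let cvg_q : q t @[t --> (0 : R)] --> (dot h h + dot h n ^+ 2 : R).
Proof.
rewrite -[X in _ --> X]addr0.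
rewrite -[X in _ --> _ + X](mul0r (dot h h * dot h n ^+ 2)).
by apply: cvgD; [exact: cvg_cst|apply: cvgM; [exact: cvg_t2|exact: cvg_cst]].
Qed.

Let cvg_kap : kap t @[t --> (0 : R)] -->
  (dot b (dot h n *: h) + dot a (cross h n) + dot r n : R).
Proof.
rewrite -[X in _ --> X]addr0 -[X in _ --> _ + X](mul0r (dot r (dot h n *: h))).
apply: cvgD; last by apply: cvgM; [exact: cvg_t2|exact: cvg_cst].
rewrite -[X in _ --> X]addr0.
rewrite -[X in _ --> _ + X](mul0r (dot a (dot h n *: h) + dot r (cross h n))).
apply: cvgD; first exact: cvg_cst.
by apply: cvgM; [exact: cvg_id|exact: cvg_cst].
Qed.

Let cvg_z1 : z1 t @[t --> (0 : R)] --> a.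
Proof.
have s1 : (sigma t)^-1 @[t --> (0 : R)] --> (1^-1 : R).
  by apply: cvgV => //; exact: cvg_sigma.
have cid : (t : R) @[t --> (0 : R)] --> (0 : R) by exact: cvg_id.
(* The limit is rewritten in the shape of [z1] at [t = 0], with [sigma = 1] and [m = n], so that
   limits can be taken term by term. *)
rewrite [X in _ --> X](_ : a =
  - (1^-1 * (0 * (dot h h + dot h n ^+ 2)) / (1 + 1)) *: b
  + 1^-1 *: (a + 0 *: r)
  - (1^-1 * 1^-1 * 1^-1 * (0 * (dot b (dot h n *: h) + dot a (cross h n)
      + dot r n))) *: n); last first.
  by rewrite !(mul0r, mulr0, oppr0, scale0r, addr0, add0r, subr0) invr1 scale1r.
apply: cvgB; first apply: cvgD.
- apply: cvgZr_tmp; apply: cvgN; apply: cvgM.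
    by apply: cvgM => //; apply: cvgM.
  apply: cvgV; first by rewrite gt_eqF// addr_gt0.
  by apply: cvgD; [exact: cvg_cst|exact: cvg_sigma].
- apply: cvgZ => //; apply: cvgD; first exact: cvg_cst.
  by apply: cvgZr_tmp.
- apply: cvgZ; last exact: cvg_cof1.
  apply: cvgM; last exact: cvgM.
  under eq_fun do rewrite exprSr expr2.
  by apply: cvgM => //; apply: cvgM.
Qed.

Let cvg_dnormal : dnormal t @[t --> (0 : R)] --> b.
Proof.
rewrite [X in _ --> X](_ : b = b + 0 *: a); last by rewrite scale0r addr0.
under eq_fun do rewrite dnormalE.
by apply: cvgD; [exact: cvg_cst|apply: cvgZ; [exact: cvg_id|exact: cvg_z1]].
Qed.

(** At [t = 0] the formula [quot] reads [a - h x b]: the term [h x b] coming from the normal cancels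
    against the one coming from the inverse of [rot1 t h], and [e x n] remains. *)
Lemma cvg_dshape_quotient :
  t^-1 *: (dshape t - b) @[t --> (0 : R)^'] --> cross e n.
Proof.
have cid : (t : R) @[t --> (0 : R)] --> (0 : R) by exact: cvg_id.
have cq : quot t @[t --> (0 : R)] --> cross e n.
  rewrite [X in _ --> X](_ : cross e n = (1 + 0 * dot h h)^-1 *:
      (a - cross h b + (0 * dot h b) *: h - (0 * dot h h) *: b)); last first.
    rewrite !(mul0r, scale0r, addr0, subr0) invr1 scale1r /a.
    by rewrite addrK.
  apply: cvgZ.
    apply: cvgV; first by rewrite mul0r addr0.
    apply: cvgD; first exact: cvg_cst.
    by apply: cvgM; [exact: cvg_t2|exact: cvg_cst].
  apply: cvgB; last by apply: cvgZr_tmp; apply: cvgM => //; exact: cvg_cst.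
  apply: cvgD; first apply: cvgB; first exact: cvg_z1.
    by apply: cvg_cross; [exact: cvg_cst|exact: cvg_dnormal].
  apply: cvgZr_tmp; apply: cvgM => //.
  by apply: cvg_dot; [exact: cvg_cst|exact: cvg_dnormal].
have cq' : quot t @[t --> (0 : R)^'] --> cross e n.
  by apply: cvg_within_filter; exact: cq.
apply: cvg_trans cq'; apply: near_eq_cvg; near=> t.
by apply/esym/quotE; near: t; exact: nbhs_dnbhs_neq.
Unshelve. all: by end_near. Qed.

End ShapeLimit.

(** * Differentiating the cofactor field and its normalisation *)

Section DeriveNormal.
Variable R : realType.
Variable V : normedModType R.
Variables (h n : V -> 'rV[R]_3) (u w : V) (t : R).
Hypotheses (dh : differentiable h u) (dn : differentiable n u).

Let cE : (fun p => cof1 t (h p) (n p)) = n + t *: (fun p => cross (h p) (n p))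
  + (fun p => (t ^+ 2 * dot (h p) (n p)) *: h p).
Proof. by []. Qed.

Let dcr : differentiable (fun p => cross (h p) (n p)) u.
Proof. exact: differentiable_cross. Qed.

Let dht : differentiable (fun p => t ^+ 2 * dot (h p) (n p)) u.
Proof. by apply: differentiableM => //; exact: differentiable_dot. Qed.

Lemma differentiable_cof1 : differentiable (fun p => cof1 t (h p) (n p)) u.
Proof.
rewrite cE; apply: differentiableD; last exact: differentiable_scale.
by apply: differentiableD => //; exact: differentiableZ.
Qed.

Lemma derive_cof1 : 'D_w (fun p => cof1 t (h p) (n p)) u =
  dcof1 (h u) (n u) ('D_w h u) ('D_w n u) t.
Proof.
rewrite cE deriveD; last 2 first.
- apply: diff_derivable.
  by apply: differentiableD => //; exact: differentiableZ.
- by apply: diff_derivable; exact: differentiable_scale.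
rewrite deriveD; last 2 first.
- exact: diff_derivable.
- by apply: diff_derivable; exact: differentiableZ.
rewrite deriveZ; last exact: diff_derivable.
rewrite derive_cross// derive_scale//.
have -> : 'D_w (fun p => t ^+ 2 * dot (h p) (n p)) u =
    t ^+ 2 * (dot ('D_w h u) (n u) + dot (h u) ('D_w n u)).
  rewrite -derive_dot//; apply: (@deriveZ _ _ _ (fun p => dot (h p) (n p))).
  by apply: diff_derivable; exact: differentiable_dot.
by rewrite /dcof1; apply: row3P; rewrite !mxE; ring.
Qed.

Hypothesis nu1 : dot (n u) (n u) = 1.

Let m p := cof1 t (h p) (n p).
Let D p := dot (m p) (m p).
Let sigma p := Num.sqrt (D p).

Let D_gt0 : 0 < D u.
Proof.
rewrite /D dot_cof1_sqr nu1 mulr_gt0// ltr_pwDl// mulr_ge0// ?sqr_ge0//.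
exact: dot_ge0.
Qed.

Let sigma_neq0 : sigma u != 0.
Proof. by rewrite gt_eqF// sqrtr_gt0. Qed.

Let ddm : differentiable m u := differentiable_cof1.

Let dsigma : differentiable sigma u.
Proof.
apply: (@differentiable_comp _ _ _ _ D Num.sqrt).
  exact: differentiable_dot.
by apply/derivable1_diffP; have [] := is_derive1_sqrt D_gt0.
Qed.

Let derive_sigma : 'D_w sigma u = (sigma u)^-1 * dot ('D_w m u) (m u).
Proof.
(* Differentiating this identity gives [2 <m', m> = 2 sigma sigma'], which is solved for
   [sigma']. *)
have DE : D = sigma * sigma.
  by apply/funext => p; rewrite -[RHS]expr2 sqr_sqrtr// dot_ge0.
have : 'D_w D u = 'D_w (sigma * sigma) u by rewrite -DE.
rewrite derive_dot// deriveM; [|exact: diff_derivable..].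
rewrite (dotC (m u)) => E.
set A := dot _ _ in E *; set B := 'D_w sigma u in E *.
have {}E : A + A = sigma u * B + sigma u * B := E.
have -> : A = sigma u * B by lra.
by rewrite mulKf.
Qed.

Lemma differentiable_normal :
  differentiable (fun p => normal_scale (h p) (n p) t *: m p) u.
Proof.
apply: differentiable_scale => //.
exact: (@differentiableV _ _ sigma).
Qed.

Lemma derive_normal : 'D_w (fun p => normal_scale (h p) (n p) t *: m p) u =
  dnormal (h u) (n u) ('D_w h u) ('D_w n u) t.
Proof.
rewrite derive_scale//; last exact: (@differentiableV _ _ sigma).
rewrite (@deriveV _ _ sigma)//; last exact: diff_derivable.
rewrite derive_sigma derive_cof1 /dnormal -/(m u) addrC -scaleNr.
congr (_ + _ *: _); rewrite /normal_scale -/(m u) -/(D u) -/(sigma u).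
by rewrite /GRing.scale /= -exprVn; ring.
Qed.

End DeriveNormal.

(** * Deformed surfaces *)

Section Surface.
Variable R : realType.
Implicit Types (M W : set 'rV[R]_3) (V : set 'rV[R]_2).
Implicit Types (g : 'rV[R]_2 -> 'rV[R]_3) (F : 'rV[R]_3 -> 'rV[R]_3).

Lemma derive_lincomb g (u v w : 'rV[R]_2) (k l : R) : differentiable g u ->
  'D_(k *: v - l *: w) g u = k *: 'D_v g u - l *: 'D_w g u.
Proof. by move=> dg; rewrite !(deriveE _ dg) linearB !linearZ. Qed.

Lemma chart_derive_cross_neq0 M V g u : chart M V g -> V u ->
  cross ('D_(delta_mx 0 0) g u) ('D_(delta_mx 0 1) g u) != 0.
Proof.
move=> cg Vu; have dg := chart_differentiable cg Vu.
apply: cross_neq0 => k l; rewrite -derive_lincomb// => D0.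
have h : k *: delta_mx 0 0 - l *: delta_mx 0 1 = 0 :> 'rV[R]_2.
  by case: cg => _ _ + _ _; apply; [exact: Vu|exact: D0].
have := congr1 (fun v : 'rV[R]_2 => v 0 0) h.
have := congr1 (fun v : 'rV[R]_2 => v 0 1) h.
rewrite !mxE/= !mulr1 !mulr0 sub0r subr0 => /eqP.
by rewrite oppr_eq0 => /eqP -> ->.
Qed.

Lemma tangent_normal M V g u n : chart M V g -> V u -> dot n n = 1 ->
  (forall X, tangent M (g u) X -> dot n X = 0) ->
  tangent M (g u) = [set Y | dot n Y = 0].
Proof.
move=> cg Vu nn nT; apply/seteqP; split => // Y /= nY.
have dg := chart_differentiable cg Vu.
have TE := tangent_chart cg Vu.
have C0 := chart_derive_cross_neq0 cg Vu.
set g1 := 'D_ _ g u in C0; set g2 := 'D_ _ g u in C0.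
have nC : cross g1 g2 = dot n (cross g1 g2) *: n.
  by apply: (unit_orth_cross nn); apply: nT; exact: (tangent_derive _ cg Vu).
set k := dot n _ in nC.
have k0 : k != 0 by apply: contra_neq C0; rewrite nC => ->; rewrite scale0r.
(* Since [g1 x g2 = k n], the right side is [(n x Y) x n = Y]; expanding the outer product instead
   exhibits [Y] as a combination of [g1] and [g2]. *)
have YE : Y = cross (k^-1 *: cross n Y) (cross g1 g2).
  rewrite nC crossZl crossZr scalerA mulVf// scale1r crossC cross_crossr.
  by rewrite nn nY scale0r sub0r opprK scale1r.
rewrite TE YE cross_crossr; set z := _ *: cross n Y.
exists (dot z g2 *: delta_mx 0 0 - dot z g1 *: delta_mx 0 1) => //.
by rewrite derive_lincomb.
Qed.

(** The closed formula for the transported normal holds only over [W], so its differential must be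
    computed from values near the point. *)
Lemma dsurf_eq_on M W F F' x X : open W -> W x ->
  (forall y, M y -> W y -> F y = F' y) -> dsurf M F x X = dsurf M F' x X.
Proof.
move=> oW Wx FF'; rewrite /dsurf; congr (xget 0 _).
have E U f u v : chart M U f -> U u -> f u = x ->
    'D_v (F \o f) u = 'D_v (F' \o f) u.
  move=> cf Uu fu; apply: near_eq_derive.
  have : nbhs u (U `&` f @^-1` W).
    apply: open_nbhs_nbhs; split; first exact: open_chart_preimage cf oW.
    by split => //=; rewrite fu.
  by apply: filterS => p [Up Wp] /=; apply: FF' => //; exact: chart_mem cf Up.
by apply/seteqP; split => Y [U [f [u [v [cf Uu fu Df ->]]]]];
  exists U, f, u, v; split => //; rewrite (E U).
Qed.

(** The deformation lives on [M] and the normal on the part of [M] in [W]; a single chart serving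
    both lets their derivatives be compared. *)
Lemma chart_within M W x : smooth_surface M -> open W -> M x -> W x ->
  exists V g u, [/\ chart M V g, chart (M `&` W) V g, V u & g u = x].
Proof.
move=> hM oW Mx Wx; have [U [f [cf [u [Uu fu]]]]] := hM _ Mx.
exists (U `&` f @^-1` W), f, u; split => //.
- exact: chart_restrict.
- exact: chart_restrict_sub.
- by split => //=; rewrite fu.
Qed.

(** * Tangent planes, differential and normal of the deformed surface *)

Section Fields.
Variables (M : set 'rV[R]_3) (xi eta tau : 'rV[R]_3 -> 'rV[R]_3).
Variables (W : set 'rV[R]_3) (nu : 'rV[R]_3 -> 'rV[R]_3).
Hypotheses (hM : smooth_surface M) (sxi : smooth_map M xi).
Hypothesis hrt : rotation_translation_fields M xi eta tau.
Hypotheses (oW : open W) (hnu : unit_normal_field (M `&` W) nu).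

Let chart_at x : M x -> W x -> exists V g u,
  [/\ chart M V g, chart (M `&` W) V g, V u & g u = x].
Proof. exact: chart_within. Qed.

Lemma tangentE x : M x -> W x -> tangent M x = [set Y | dot (nu x) Y = 0].
Proof.
move=> Mx Wx; have [V [g [u [cg cgW Vu <-]]]] := chart_at Mx Wx.
have MWx : (M `&` W) (g u) by exact: chart_mem cgW Vu.
case: hnu => _ n1 n0; apply: (tangent_normal cg Vu); first exact: n1.
by move=> X; rewrite (tangent_chart cg Vu) -(tangent_chart cgW Vu); exact: n0.
Qed.

Let dsurf_id x X : M x -> W x -> tangent M x X -> dsurf M id x X = X.
Proof.
move=> Mx Wx; have [V [g [u [cg _ Vu <-]]]] := chart_at Mx Wx.
rewrite (tangent_chart cg Vu) => -[w _ <-].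
exact: (dsurf_chart w cg Vu (F := id) (chart_differentiable cg Vu)).
Qed.

Let dsurf_xi x X : M x -> W x -> tangent M x X ->
  dsurf M xi x X = cross (eta x) X.
Proof.
move=> Mx Wx TX; case: hrt => _ _ _ h _.
by rewrite h// dsurf_id.
Qed.

Lemma dsurf_phi t x X : M x -> W x -> tangent M x X ->
  dsurf M (phi xi t) x X = rot1 t (eta x) X.
Proof.
move=> Mx Wx TX; rewrite /rot1 -dsurf_xi//.
have [V [g [u [cg _ Vu gu]]]] := chart_at Mx Wx.
have dg := chart_differentiable cg Vu.
have dxi : differentiable (xi \o g) u.
  by exact: smooth_differentiable (sxi cg) Vu.
move: TX; rewrite -gu (tangent_chart cg Vu) => -[w _ <-].
have E : phi xi t \o g = g + t *: (xi \o g) by [].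
have dphi : differentiable (phi xi t \o g) u.
  by rewrite E; apply: differentiableD => //; exact: differentiableZ.
rewrite (dsurf_chart w cg Vu dphi) (dsurf_chart w cg Vu dxi) E.
rewrite deriveD; [|exact: diff_derivable|].
  by rewrite deriveZ//; exact: diff_derivable.
by apply: derivableZ; exact: diff_derivable.
Qed.

(** The cofactor identities show that the normalised vector satisfies the three defining conditions;
    evaluating those conditions on one positively oriented frame determines the normal. *)
Lemma transported_normalE t x : M x -> W x ->
  transported_normal M nu (phi xi t) x =
  normal_scale (eta x) (nu x) t *: cof1 t (eta x) (nu x).
Proof.
move=> Mx Wx; have [_ /(_ x (conj Mx Wx)) nn _] := hnu.
have TE := tangentE Mx Wx.
have nT X : tangent M x X -> dot (nu x) X = 0 by rewrite TE.
rewrite /normal_scale; set m := cof1 t (eta x) (nu x).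
have D0 : 0 < dot m m.
  rewrite dot_cof1_sqr nn mulr_gt0// ltr_pwDl// mulr_ge0// ?sqr_ge0//.
  exact: dot_ge0.
set s := Num.sqrt (dot m m); have s0 : 0 < s by rewrite sqrtr_gt0.
have sD : dot m m = s ^+ 2 by rewrite sqr_sqrtr// ltW.
have P : [/\ dot (s^-1 *: m) (s^-1 *: m) = 1,
    forall X, tangent M x X -> dot (s^-1 *: m) (dsurf M (phi xi t) x X) = 0 &
    forall X Y, tangent M x X -> tangent M x Y ->
      0 < dot (nu x) (cross X Y) -> 0 < dot (s^-1 *: m)
        (cross (dsurf M (phi xi t) x X) (dsurf M (phi xi t) x Y))].
  split.
  - by rewrite dotZl dotZr sD; field; rewrite gt_eqF.
  - by move=> X TX; rewrite dsurf_phi// dotZl dot_cof1_rot1 nT// !mulr0.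
  - move=> X Y TX TY p; rewrite !dsurf_phi// cross_rot1.
    rewrite (unit_orth_cross nn (nT _ TX) (nT _ TY)) cof1Z dotZl dotZr.
    by rewrite !mulr_gt0// invr_gt0.
(* The test frame is [X0] and [nu x X0]; its orientation is positive because the triple product with
   [nu] is [|X0|^2]. *)
have [X0 TX0 X00] : exists2 X0, tangent M x X0 & X0 != 0.
  have [V [g [u [cg _ Vu <-]]]] := chart_at Mx Wx.
  exists ('D_(delta_mx 0 0) g u); first exact: (tangent_derive _ cg Vu).
  apply: contra_neq (chart_derive_cross_neq0 cg Vu) => ->.
  by rewrite crossC crossr0 oppr0.
have TY0 : tangent M x (cross (nu x) X0) by rewrite TE /= dot_crossl.
have p0 : 0 < dot (nu x) (cross X0 (cross (nu x) X0)).
  rewrite cross_crossr (dotC X0 (nu x)) (nT _ TX0) scale0r subr0 dotZr nn mulr1.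
  rewrite lt_neqAle dot_ge0 andbT eq_sym; apply: contra_neq X00; exact: dot_eq0.
apply: xget_unique => // n' [n1' n0' np']; case: P => n1 n0 np.
apply: (unit_normal_uniq n1' (n0' _ TX0) (n0' _ TY0) (np' _ _ TX0 TY0 p0) n1
  (n0 _ TX0) (n0 _ TY0) (np _ _ TX0 TY0 p0)).
Qed.

(** * Computation in a chart around a point of [M] in [W] *)

Section AtPoint.
Variables (V : set 'rV[R]_2) (g : 'rV[R]_2 -> 'rV[R]_3) (u w : 'rV[R]_2).
Hypotheses (cg : chart M V g) (cgW : chart (M `&` W) V g) (Vu : V u).

Let x := g u.
Let X := 'D_w g u.
Let e := 'D_w (eta \o g) u.
Let b := 'D_w (nu \o g) u.

Let MWx : (M `&` W) x. Proof. exact: chart_mem cgW Vu. Qed.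
Let Mx : M x. Proof. by case: MWx. Qed.
Let Wx : W x. Proof. by case: MWx. Qed.
Let TX : tangent M x X. Proof. exact: (tangent_derive w cg Vu). Qed.

Let deta : differentiable (eta \o g) u.
Proof.
by case: hrt => + _ _ _ _ => /(_ _ _ cg)/smooth_differentiable; exact.
Qed.

Let dnu : differentiable (nu \o g) u.
Proof. by case: hnu => + _ _ => /(_ _ _ cgW)/smooth_differentiable; exact. Qed.

Let nn : dot (nu x) (nu x) = 1.
Proof. by case: hnu => _ + _; exact. Qed.

Lemma dot_shape_normal : dot b (nu x) = 0.
Proof.
have : 'D_w (fun p => dot ((nu \o g) p) ((nu \o g) p)) u = 0.
  rewrite -(derive_cst (1 : R) u w); apply: near_eq_derive.
  have : nbhs u V by apply: open_nbhs_nbhs; split => //; case: cg.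
  apply: filterS => p Vp /=; case: hnu => _ + _; apply; exact: chart_mem cgW Vp.
rewrite derive_dot// [dot (_ u) _]dotC -/b /= -/x -mulr2n -mulr_natl => /eqP.
by rewrite mulf_eq0 pnatr_eq0 => /eqP.
Qed.

(* Equality of the mixed derivatives of [xi \o g] and of [g]. *)
Lemma cross_deta_symm v :
  cross e ('D_v g u) = cross ('D_v (eta \o g) u) ('D_w g u).
Proof.
have [oV sg _ _ _] := cg.
have D1 z p : V p -> 'D_z (xi \o g) p = cross ((eta \o g) p) ('D_z g p).
  move=> Vp; have MWp : (M `&` W) (g p) by exact: chart_mem cgW Vp.
  rewrite -(dsurf_chart z cg Vp); last exact: smooth_differentiable (sxi cg) Vp.
  by rewrite dsurf_xi//; [case: MWp..|exact: (tangent_derive z cg Vp)].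
have nV : nbhs u V by exact: open_nbhs_nbhs.
have dDg z : differentiable (fun p => 'D_z g p) u.
  by case: (sg 2%N) => _ /(_ z)[+ _]; apply.
have D2 z z' : 'D_z (fun p => 'D_z' (xi \o g) p) u =
    cross ('D_z (eta \o g) u) ('D_z' g u) +
    cross (eta x) ('D_z (fun p => 'D_z' g p) u).
  rewrite -(derive_cross z deta (dDg z')); apply: near_eq_derive.
  by apply: filterS nV => p; exact: D1.
have Exi := smooth_derive_mixedC v w oV Vu (sxi cg).
have Eg := smooth_derive_mixedC v w oV Vu sg.
(* By [Eg] the terms with second derivatives of [g] coincide and drop out. *)
by move: Exi; rewrite (D2 w v) (D2 v w) Eg => /addIr.
Qed.

(** The symmetry relation is used with the direction whose image is [nu x X]: pairing it with [X]
    kills one side and leaves [|X|^2 <nu, e> = 0]. *)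
Lemma dot_deta_normal : dot (nu x) e = 0.
Proof.
have nX : dot (nu x) X = 0 by move: TX; rewrite tangentE.
have [v _ vE] : range (fun v => 'D_v g u) (cross (nu x) X).
  by rewrite -(tangent_chart cg Vu) tangentE //= dot_crossl.
(* For [X = 0] the immersion property gives [w = 0], so [e] vanishes as well. *)
have [X0|X0] := eqVneq X 0.
  suff w0 : w = 0 by rewrite /e w0 derive0 dot0r.
  by case: cg => _ _ + _ _; apply; eauto.
have := congr1 (dot X) (cross_deta_symm v); rewrite vE dot_crossr.
rewrite dot_cross_cross nX mul0r sub0r => /eqP.
rewrite oppr_eq0 mulf_eq0 => /orP[/eqP/dot_eq0|/eqP//].
by move/eqP; rewrite (negPf X0).
Qed.

Lemma dsurf_transported_normal t :
  dsurf M (transported_normal M nu (phi xi t)) x X =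
  dnormal (eta x) (nu x) e b t.
Proof.
rewrite (dsurf_eq_on X oW Wx (fun y My Wy => transported_normalE t My Wy)).
rewrite -(derive_normal w t deta dnu nn).
by apply: (dsurf_chart w cg Vu); exact: (differentiable_normal t deta dnu nn).
Qed.

Let dsurf_inv_rot1 t Y : dot (nu x) Y = 0 ->
  dsurf_inv M (phi xi t) x (rot1 t (eta x) Y) = Y.
Proof.
move=> nY; have TY : tangent M x Y by rewrite tangentE.
apply: xget_unique; first by split => //; exact: dsurf_phi.
by move=> Z [TZ]; rewrite dsurf_phi// => /rot1_inj.
Qed.

Lemma pullback_shape_opE t :
  pullback_shape_op M xi nu t x X = dshape (eta x) (nu x) e b t.
Proof.
have nX : dot (nu x) X = 0 by move: TX; rewrite tangentE.
rewrite /pullback_shape_op /deformed_shape_op /dsurf_along.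
rewrite dsurf_phi// dsurf_inv_rot1// dsurf_transported_normal /dshape.
set z := dnormal _ _ _ _ t; set d := 1 + _.
have d0 : d != 0.
  by rewrite gt_eqF// ltr_pwDl// mulr_ge0 ?sqr_ge0// dot_ge0.
(* The adjugate writes [z] as an image under [rot1]; the preimage is tangent because
   [<nu, cof1 (- t) z> = <cof1 t nu, z> = 0]. *)
rewrite -[in LHS](scale1r z) -(mulVf d0) -scalerA -rot1_cof1.
rewrite -rot1Z; apply: dsurf_inv_rot1; rewrite dotZr dot_cof1N.
by rewrite /z dot_cof1_dnormal ?mulr0//; exact: dot_shape_normal.
Qed.

Lemma cvg_shape_op_quotient :
  shape_op_quotient M xi nu x X t @[t --> (0 : R)^'] --> cross e (nu x).
Proof.
have -> : shape_op_quotient M xi nu x X =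
    fun t => t^-1 *: (dshape (eta x) (nu x) e b t - b).
  apply/funext => t; rewrite /shape_op_quotient pullback_shape_opE.
  by rewrite /shape_op (dsurf_chart w cg Vu dnu).
exact: cvg_dshape_quotient nn dot_shape_normal.
Qed.

Lemma shape_op_dotE : shape_op_dot M xi nu x X = cross e (nu x).
Proof. by apply: cvg_lim => //; exact: cvg_shape_op_quotient. Qed.

Lemma dsurf_rotation_field :
  dsurf M eta x X = rotJ nu x (shape_op_dot M xi nu x X).
Proof.
rewrite (dsurf_chart w cg Vu deta) shape_op_dotE /rotJ cross_crossr nn.
by rewrite dot_deta_normal scale0r subr0 scale1r.
Qed.

(** With [q] the derivative of the shape operator, [x x (nu x q) = <x, q> nu - <x, nu> q]; the first
    term is normal and the second tangent. *)
Lemma dsurf_translation_field : orth_proj (tangent M x) (dsurf M tau x X) =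
  - support_fun nu x *: shape_op_dot M xi nu x X.
Proof.
have -> : dsurf M tau x X = cross x (rotJ nu x (shape_op_dot M xi nu x X)).
  by case: hrt => _ _ _ _ ->//; rewrite dsurf_rotation_field.
rewrite shape_op_dotE /rotJ /support_fun tangentE// cross_crossr.
set q := cross e (nu x).
have nq : dot (nu x) q = 0 by rewrite dot_crossr.
apply: orth_projE => /= [y z ny nz||z nz].
- by rewrite dotDr -scaleN1r dotZr ny nz mulr0 addr0.
- by rewrite dotZr nq mulr0.
- by rewrite (dotC x (nu x)) scaleNr opprK subrK dotZl nz mulr0.
Qed.

End AtPoint.
End Fields.
End Surface.

Theorem lemma3p9 (R : realType) (M : set 'rV[R]_3)
    (xi eta tau : 'rV[R]_3 -> 'rV[R]_3)
    (W : set 'rV[R]_3) (nu : 'rV[R]_3 -> 'rV[R]_3)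
    (hM : smooth_surface M)
    (hxi : isometric_deformation M xi)
    (hrt : rotation_translation_fields M xi eta tau)
    (hW : open W)
    (hnu : unit_normal_field (M `&` W) nu)
    (x X : 'rV[R]_3) (hx : M x) (hxW : W x) (hX : tangent M x X) :
  [/\ cvg (shape_op_quotient M xi nu x X t @[t --> (0 : R)^']),
      dsurf M eta x X = rotJ nu x (shape_op_dot M xi nu x X) &
      orth_proj (tangent M x) (dsurf M tau x X) =
        - support_fun nu x *: shape_op_dot M xi nu x X].
Proof.
have [sxi _] := hxi.
have [V [g [u [cg cgW Vu gu]]]] := chart_within hM hW hx hxW.
have [w _ <-] : range (fun w => 'D_w g u) X.
  by rewrite -(tangent_chart cg Vu) gu.
rewrite -gu.
split.
- apply/cvg_ex; eexists.
  exact: (cvg_shape_op_quotient hM sxi hrt hW hnu cg cgW Vu).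
- exact: (dsurf_rotation_field hM sxi hrt hW hnu w cg cgW Vu).
- exact: (dsurf_translation_field hM sxi hrt hW hnu w cg cgW Vu).
Qed.
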